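(* Let $\sigma\in S_n$, $a\in\{1,\dots,n-1\}$, $I\in\mathcal I_\lambda$, and suppose $\sigma(a)\in I_k$, $\sigma(a+1)\in I_l$. Write $\sigma s_{a,a+1}$ for the permutation $m\mapsto\sigma(s_{a,a+1}(m))$ and $I'=s_{\sigma(a),\sigma(a+1)}(I)$. Then, with $w=z_{\sigma(a)}/z_{\sigma(a+1)}$: if $k=l$, $W_{\sigma s_{a,a+1},I}=W_{\sigma,I}$; if $k<l$, $W_{\sigma s_{a,a+1},I}=h\frac{1-w}{1-hw}W_{\sigma,I}+\frac{1-h}{1-hw}W_{\sigma,I'}$; if $k>l$, $W_{\sigma s_{a,a+1},I}=\frac{1-w}{1-hw}W_{\sigma,I}+(1-h)\frac{w}{1-hw}W_{\sigma,I'}$.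
   Context: Fix $N,n$, $\lambda\in\mathbb Z_{\ge0}^N$, $\sum\lambda_k=n$; $\lambda^{(k)}=\lambda_1+\dots+\lambda_k$, $\lambda^{\{1\}}=\sum_{k=1}^{N-1}\lambda^{(k)}$. $\mathcal I_\lambda$ = ordered partitions $I=(I_1,\dots,I_N)$ of $\{1,\dots,n\}$ with $|I_k|=\lambda_k$; $I_1\cup\dots\cup I_k=\{i^{(k)}_1<\dots<i^{(k)}_{\lambda^{(k)}}\}$; for $\tau\in S_n$, $\tau(I)=(\tau(I_1),\dots,\tau(I_N))$; $s_{a,b}$ denotes the transposition of $a$ and $b$. Weight functions: variables $t^{(k)}_a$ ($1\le k\le N-1$), $z_1,\dots,z_n$, $h$, $t^{(N)}_a=z_a$; $U_I=\prod_{k=1}^{N-1}\prod_{a=1}^{\lambda^{(k)}}\Big(\prod_{c:\,i^{(k+1)}_c<i^{(k)}_a}(1-ht^{(k+1)}_c/t^{(k)}_a)\prod_{c:\,i^{(k+1)}_c>i^{(k)}_a}(1-t^{(k+1)}_c/t^{(k)}_a)\prod_{b=a+1}^{\lambda^{(k)}}\frac{1-ht^{(k)}_b/t^{(k)}_a}{1-t^{(k)}_b/t^{(k)}_a}\Big)$ ($c\in\{1..\lambda^{(k+1)}\}$); $W_I=(1-h)^{\lambda^{\{1\}}}\mathrm{Sym}_{t^{(1)}}\cdots\mathrm{Sym}_{t^{(N-1)}}U_I$ (sum over permutations within each group $t^{(k)}$); $W_{\sigma,I}(t,z,h)=W_{\sigma^{-1}(I)}(t,z_{\sigma(1)},\dots,z_{\sigma(n)},h)$.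 The identities are identities of functions of $t,z,h$. *)

(* Defs.v *)
(* Weight functions W_I of the paper, evaluated pointwise
   in an arbitrary field F. *)
From HB Require Import structures.
From mathcomp Require Import all_boot all_order all_algebra all_fingroup.
Set Implicit Arguments. Unset Strict Implicit. Unset Printing Implicit Defensive.
Import GRing.Theory.
Local Open Scope ring_scope.

(* Conventions: blocks k = 1..N and indices a = 1..lambda^(k) are 1-based nats;
   the ground set {1..n} is 'I_n (element i : 'I_n stands for i+1). *)

Definition lamc (lam : nat -> nat) (k : nat) : nat := (\sum_(1 <= j < k.+1) lam j)%N.

Definition lam1 (N : nat) (lam : nat -> nat) : nat := (\sum_(1 <= k < N) lamc lam k)%N.

Definition in_Ilam (n N : nat) (lam : nat -> nat) (I : nat -> {set 'I_n}) : Prop :=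
  [/\ (forall k, (1 <= k <= N)%N -> #|I k| = lam k),
      (forall x : 'I_n, exists2 k, (1 <= k <= N)%N & x \in I k) &
      (forall k l, (1 <= k <= N)%N -> (1 <= l <= N)%N -> k <> l ->
         [disjoint I k & I l])].

Definition blockU (n : nat) (I : nat -> {set 'I_n}) (k : nat) : {set 'I_n} :=
  \bigcup_(1 <= j < k.+1) I j.

(* i^(k)_a (1-based a), returned as the 0-based value of the element *)
Definition ipos (n : nat) (I : nat -> {set 'I_n}) (k a : nat) : nat :=
  nth 0%N (sort leq [seq val x | x in blockU I k]) a.-1.

(* the full family of variables: t^(k)_a for k < N, and t^(N)_a = z_a *)
Definition ttz (F : fieldType) (n N : nat) (t : nat -> nat -> F) (z : 'I_n -> F)
  (k a : nat) : F :=
  if k == N then oapp z 0 (@insub _ _ 'I_n a.-1) else t k a.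

Definition U_I (F : fieldType) (n N : nat) (lam : nat -> nat) (I : nat -> {set 'I_n})
  (h : F) (tt : nat -> nat -> F) : F :=
  \prod_(1 <= k < N) \prod_(1 <= a < (lamc lam k).+1)
    ((\prod_(1 <= c < (lamc lam k.+1).+1 | (ipos I k.+1 c < ipos I k a)%N)
        (1 - h * tt k.+1 c / tt k a)) *
     (\prod_(1 <= c < (lamc lam k.+1).+1 | (ipos I k a < ipos I k.+1 c)%N)
        (1 - tt k.+1 c / tt k a)) *
     (\prod_(a.+1 <= b < (lamc lam k).+1)
        ((1 - h * tt k b / tt k a) / (1 - tt k b / tt k a)))).

(* action of s in S_m on 1-based indices 1..m *)
Definition perm_nat (m : nat) (s : 'S_m) (a : nat) : nat :=
  if a is a'.+1 then oapp (fun i : 'I_m => (s i).+1) a (@insub _ _ 'I_m a') else a.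

Definition symk (F : fieldType) (lam : nat -> nat) (k : nat)
  (G : (nat -> nat -> F) -> F) (tt : nat -> nat -> F) : F :=
  \sum_(s : 'S_(lamc lam k))
     G (fun j b => if j == k then tt k (perm_nat s b) else tt j b).

Definition symAll (F : fieldType) (N : nat) (lam : nat -> nat)
  (G : (nat -> nat -> F) -> F) : (nat -> nat -> F) -> F :=
  foldr (fun k G' => symk lam k G') G (iota 1 N.-1).

Definition W_I (F : fieldType) (n N : nat) (lam : nat -> nat) (I : nat -> {set 'I_n})
  (t : nat -> nat -> F) (z : 'I_n -> F) (h : F) : F :=
  (1 - h) ^+ lam1 N lam * symAll N lam (U_I N lam I h) (ttz N t z).

Definition W_sig (F : fieldType) (n N : nat) (lam : nat -> nat) (sigma : 'S_n)
  (I : nat -> {set 'I_n}) (t : nat -> nat -> F) (z : 'I_n -> F) (h : F) : F :=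
  W_I N lam (fun k => (sigma^-1)%g @: I k) t (fun i => z (sigma i)) h.

(* Main.v *)
Require Import Defs.
From HB Require Import structures.
From mathcomp Require Import all_boot all_order all_algebra all_fingroup.
From mathcomp Require Import ring zify.
Set Implicit Arguments. Unset Strict Implicit. Unset Printing Implicit Defensive.
Import GRing.Theory.
Local Open Scope ring_scope.

(** Read the variables t^(j) of level j as values attached to the positions in
    S_j = I_1 ∪ ... ∪ I_j. Symmetrizing the levels from the bottom up gives
    functions V_j of the values on S_j, with
      V_{j+1}(Y) = sum over assignments X of t^(j) of V_j(X) * level_j(X, Y),
    and W_I is V_N up to the power of 1 - h.

    Swapping the adjacent positions a and a1 = a + 1 affects only the factors in
    which both occur. Let V' be the functions of the swapped partition, tau the
    transposition, u = X a, v = X a1, and suppose that a enters no later than a1.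
    From the level where both positions are present on,
      (v - h u) V'(X tau) = h (v - u) V(X) + (1 - h) v V'(X),
      (v - h u) V (X tau) =   (v - u) V'(X) + (1 - h) u V(X).
    This pair of relations is checked factor by factor at the level where a1
    enters, and it propagates: pairing each assignment X with X tau reduces the
    step to a rational identity in four variables. The three cases of the theorem
    are these relations at level N, solved for the left-hand sides. *)

(** * Factors of one level, indexed by positions *)

Section Factors.
Variables (F : fieldType) (n : nat).
Implicit Types (S : {set 'I_n}) (X Y : 'I_n -> F) (f g : 'I_n -> 'I_n -> F -> F -> F).

(** The factors receive the positions besides the values, so that they can test the order of two
    positions or their membership in a chosen pair. *)
Definition pairprod f g S1 S2 X Y : F :=
  \prod_(i in S1) (\prod_(j in S2) f i j (X i) (Y j) *
                   \prod_(j in S1) g i j (X i) (X j)).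

Lemma eq_pairprod f g S1 S2 X X' Y Y' : X =1 X' -> Y =1 Y' ->
  pairprod f g S1 S2 X Y = pairprod f g S1 S2 X' Y'.
Proof.
move=> eX eY; apply: eq_bigr => i _.
by congr (_ * _); apply: eq_bigr => j _; rewrite !(eX, eY).
Qed.

Lemma pairprodM f f' g g' S1 S2 X Y :
  pairprod (fun i j u v => f i j u v * f' i j u v)
           (fun i j u v => g i j u v * g' i j u v) S1 S2 X Y
  = pairprod f g S1 S2 X Y * pairprod f' g' S1 S2 X Y.
Proof.
by rewrite -big_split; apply: eq_bigr => i _; rewrite !big_split /= mulrACA.
Qed.

Lemma eq_pairprod_fun f f' g g' S1 S2 X Y :
    (forall i j u v, f i j u v = f' i j u v) ->
    (forall i j u v, g i j u v = g' i j u v) ->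
  pairprod f g S1 S2 X Y = pairprod f' g' S1 S2 X Y.
Proof.
move=> ef eg; apply: eq_bigr => i _.
by congr (_ * _); apply: eq_bigr => j _; rewrite !(ef, eg).
Qed.

Variables (h : F).

Definition cross (i j : 'I_n) (u v : F) : F :=
  if (j < i)%N then 1 - h * v / u else if (i < j)%N then 1 - v / u else 1.

Definition within (i j : 'I_n) (u v : F) : F :=
  if (i < j)%N then (1 - h * v / u) / (1 - v / u) else 1.

Variables (a a1 : 'I_n).
Hypothesis a1E : a1 = a.+1 :> nat.
Let tau := tperm a a1.

Definition in_pair (i : 'I_n) := (i == a) || (i == a1).

Definition off_pair f i j u v : F := if in_pair i && in_pair j then 1 else f i j u v.
Definition on_pair f i j u v : F := if in_pair i && in_pair j then f i j u v else 1.

Lemma in_pair_tperm i : in_pair (tau i) = in_pair i.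
Proof.
rewrite /in_pair /tau; case: tpermP => [->|->|/eqP/negPf-> /eqP/negPf->] //;
by rewrite !eqxx !(orbT, orTb).
Qed.

(** No third position lies between [a] and [a1]. *)
Lemma ltn_tperm_l i j : ~~ (in_pair i && in_pair j) -> (tau i < j)%N = (i < j)%N.
Proof.
rewrite /in_pair /tau; case: tpermP => [->|->|//]; rewrite eqxx ?orbT /= => /norP[];
rewrite -!val_eqE /= a1E; lia.
Qed.

Lemma ltn_tperm_r i j : ~~ (in_pair i && in_pair j) -> (i < tau j)%N = (i < j)%N.
Proof.
rewrite /in_pair /tau; case: tpermP => [->|->|//]; rewrite eqxx ?orbT andbT => /norP[];
rewrite -!val_eqE /= a1E; lia.
Qed.

Lemma off_cross_l i j u v : off_pair cross (tau i) j u v = off_pair cross i j u v.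
Proof.
rewrite /off_pair in_pair_tperm; case: ifPn => // nij.
by rewrite /cross ltn_tperm_l // ltn_tperm_r // andbC.
Qed.

Lemma off_cross_r i j u v : off_pair cross i (tau j) u v = off_pair cross i j u v.
Proof.
rewrite /off_pair in_pair_tperm; case: ifPn => // nij.
by rewrite /cross ltn_tperm_r // ltn_tperm_l // andbC.
Qed.

Lemma off_within_l i j u v : off_pair within (tau i) j u v = off_pair within i j u v.
Proof.
rewrite /off_pair in_pair_tperm; case: ifPn => // nij.
by rewrite /within ltn_tperm_l.
Qed.

Lemma off_within_r i j u v : off_pair within i (tau j) u v = off_pair within i j u v.
Proof.
rewrite /off_pair in_pair_tperm; case: ifPn => // nij.
by rewrite /within ltn_tperm_r.
Qed.

Definition level := pairprod cross within.
Definition level_off := pairprod (off_pair cross) (off_pair within).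

Lemma level_off_l S1 S2 X Y :
  level_off (tau @: S1) S2 (X \o tau) Y = level_off S1 S2 X Y.
Proof.
have tI S : {in S &, injective tau} by move=> ? ? _ _; apply: perm_inj.
rewrite /level_off /pairprod big_imset //; apply: eq_bigr => i _ /=.
rewrite /tau tpermK -/tau; congr (_ * _).
  by apply: eq_bigr => j _; rewrite off_cross_l.
rewrite big_imset //; apply: eq_bigr => j _ /=.
by rewrite off_within_l off_within_r /tau tpermK.
Qed.

Lemma level_off_r S1 S2 X Y :
  level_off S1 (tau @: S2) X (Y \o tau) = level_off S1 S2 X Y.
Proof.
have tI S : {in S &, injective tau} by move=> ? ? _ _; apply: perm_inj.
apply: eq_bigr => i _ /=; congr (_ * _).
by rewrite big_imset //; apply: eq_bigr => j _ /=; rewrite off_cross_r /tau tpermK.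
Qed.

Lemma a_neq_a1 : a1 != a. Proof. by rewrite -val_eqE /= a1E; lia. Qed.

Lemma prod_in_pair S (G : 'I_n -> F) : (forall i, ~~ in_pair i -> G i = 1) ->
  \prod_(i in S) G i = (if a \in S then G a else 1) * (if a1 \in S then G a1 else 1).
Proof.
move=> G1; rewrite big_mkcond (bigD1 a) //= (bigD1 a1) ?a_neq_a1 //= big1 ?mulr1 //.
by move=> i /andP[ia ia1]; rewrite G1 ?if_same // negb_or ia.
Qed.

(** The product over [on_pair] written out: diagonal factors are 1, and since [a < a1] only the
    ordered pair ([a], [a1]) has a nontrivial [within] factor. *)
Definition level_on S1 S2 X Y : F :=
  (if a \in S1 then (if a1 \in S2 then 1 - Y a1 / X a else 1) *
     (if a1 \in S1 then (1 - h * X a1 / X a) / (1 - X a1 / X a) else 1) else 1) *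
  (if a1 \in S1 then (if a \in S2 then 1 - h * Y a / X a1 else 1) else 1).

Lemma levelE S1 S2 X Y : level S1 S2 X Y = level_off S1 S2 X Y * level_on S1 S2 X Y.
Proof.
have -> : level_on S1 S2 X Y = pairprod (on_pair cross) (on_pair within) S1 S2 X Y.
  have on1 i j f u v : ~~ in_pair i || ~~ in_pair j -> on_pair f i j u v = 1.
    by rewrite -negb_and /on_pair => /negPf->.
  have pa : in_pair a by rewrite /in_pair eqxx.
  have pa1 : in_pair a1 by rewrite /in_pair eqxx orbT.
  rewrite /pairprod prod_in_pair; last first.
    by move=> i ni; rewrite !big1 ?mulr1 // => j _; rewrite on1 ?ni.
  rewrite !prod_in_pair; try by move=> i ni; rewrite on1 ?ni ?orbT.
  rewrite /on_pair !pa !pa1 /= /cross /within !ltnn a1E !ltnSn.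
  have -> : (a.+1 < a)%N = false by lia.
  by rewrite !if_same !(mulr1, mul1r).
rewrite -pairprodM; apply: eq_pairprod_fun => i j u v;
by rewrite /off_pair /on_pair; case: ifP; rewrite ?mulr1 ?mul1r.
Qed.

End Factors.

(** * Ranks of positions in a set *)

Section Ranks.
Variables (n : nat).
Implicit Types (S : {set 'I_n}) (i j : 'I_n).

Definition positions S : seq nat := sort leq [seq val x | x in S].
(** Starts at 1, like the indices of the variables. Outside [S] it is [#|S|.+1], a value taken by no
    element of [S]. *)
Definition rank S i : nat := (index (val i) (positions S)).+1.

Lemma size_positions S : size (positions S) = #|S|.
Proof. by rewrite size_sort size_image. Qed.

Lemma mem_positions S i : (val i \in positions S) = (i \in S).
Proof. by rewrite mem_sort mem_map ?mem_enum //; apply: val_inj. Qed.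

Lemma uniq_positions S : uniq (positions S).
Proof. by rewrite sort_uniq map_inj_uniq ?enum_uniq //; apply: val_inj. Qed.

Lemma sorted_positions S : sorted leq (positions S).
Proof. exact/sort_sorted/leq_total. Qed.

Lemma rank_le_card S i : i \in S -> (rank S i <= #|S|)%N.
Proof. by move=> iS; rewrite /rank -size_positions index_mem mem_positions. Qed.

Lemma rank_inj S i j : i \in S -> rank S i = rank S j -> i = j.
Proof.
move=> iS [] eij; apply: val_inj.
have iP : val i \in positions S by rewrite mem_positions.
have jP : val j \in positions S by rewrite -index_mem -eij index_mem.
by rewrite -(nth_index 0%N iP) eij nth_index.
Qed.

Lemma ltn_rank S i j : i \in S -> j \in S -> (rank S i < rank S j)%N = (i < j)%N.
Proof.
move=> iS jS; rewrite /rank ltnS.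
have lt_sorted : sorted ltn (positions S).
  by rewrite ltn_sorted_uniq_leq uniq_positions sorted_positions.
have lt_of x y : x \in S -> y \in S ->
    (index (val x) (positions S) < index (val y) (positions S))%N -> (x < y)%N.
  by move=> xS yS; apply: (sorted_ltn_index ltn_trans lt_sorted); rewrite mem_positions.
case: (ltngtP (index _ _) (index _ _)) => [/lt_of->//|/lt_of lt_ji|eij].
  by apply/esym/negbTE; rewrite -leqNgt ltnW // lt_ji.
have -> : i = j by apply: (@rank_inj S) => //; rewrite /rank eij.
by rewrite ltnn.
Qed.

Lemma rank_setT i : rank [set: 'I_n] i = i.+1.
Proof.
have -> : rank [set: 'I_n] i = (index (val i) (iota 0 n)).+1.
  congr (index _ _).+1; apply: (sorted_eq leq_trans anti_leq).
  - exact: sorted_positions.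
  - exact: iota_sorted.
  rewrite perm_sort -val_enum_ord; apply: perm_map.
  by apply: uniq_perm; rewrite ?enum_uniq // => x; rewrite !mem_enum !inE.
by have := @index_uniq _ 0%N i (iota 0 n); rewrite size_iota nth_iota // iota_uniq => ->.
Qed.

Lemma big_rank (R : Type) (op : SemiGroup.com_law R) (idx : R) S
    (P : nat -> nat -> bool) (G : nat -> nat -> R) :
  \big[op/idx]_(1 <= b < #|S|.+1 | P b (nth 0%N (positions S) b.-1))
    G b (nth 0%N (positions S) b.-1)
  = \big[op/idx]_(i in S | P (rank S i) (val i)) G (rank S i) (val i).
Proof.
rewrite big_add1 /= -size_positions.
transitivity (\big[op/idx]_(v <- positions S | P (index v (positions S)).+1 v)
   G (index v (positions S)).+1 v).
  rewrite [RHS](big_nth 0%N) big_nat_cond [RHS]big_nat_cond.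
  apply: eq_big => b; first by case: ltnP => //= b_lt; rewrite index_uniq ?uniq_positions.
  by case/andP=> /andP[_ b_lt] _; rewrite index_uniq ?uniq_positions.
rewrite (perm_big _ (permEl (perm_sort _ _))) /= big_map.
by rewrite big_enum_cond.
Qed.

(** With [a1] absent, moving [a] to [a1] jumps over no element of [S], so the order is kept. *)
Lemma rank_tperm S (a a1 : 'I_n) i : a1 = a.+1 :> nat -> a1 \notin S ->
  rank (tperm a a1 @: S) i = rank S (tperm a a1 i).
Proof.
move=> a1E a1S; congr _.+1.
(* The transposition on natural numbers; it is monotone away from [a.+1], so it maps the sorted list
   of [S] to a sorted list. *)
pose f (m : nat) := if m == a then a.+1 else if m == a.+1 then a : nat else m.
have fE x : val (tperm a a1 x) = f x.
  rewrite /f; case: tpermP => [->|->|]; rewrite ?eqxx //= ?a1E //.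
    by rewrite eqn_leq ltnn eqxx.
  move=> /eqP; rewrite -val_eqE /= => /negPf->.
  by move=> /eqP; rewrite -val_eqE /= a1E => /negPf->.
have f_inj : injective f by move=> x y; rewrite /f; do ![case: eqP]; lia.
have -> : positions (tperm a a1 @: S) = map f (positions S).
  apply: (sorted_eq leq_trans anti_leq); first exact: sorted_positions.
    apply: (@homo_sorted_in _ _ (fun m => m != a.+1) f leq) (sorted_positions S).
      by move=> x y; rewrite !unfold_in /f; do ![case: eqP]; lia.
    apply/allP=> m; rewrite mem_sort => /mapP[x]; rewrite mem_enum => xS ->.
    by rewrite -a1E val_eqE; apply: contraNneq a1S => <-.
  apply: uniq_perm; rewrite ?uniq_positions ?map_inj_uniq ?uniq_positions // => m.
  apply/idP/mapP => [|[m']]; rewrite mem_sort => /mapP[x]; rewrite mem_enum.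
    by move=> /imsetP[y yS ->] ->; exists (val y); rewrite ?fE ?mem_positions.
  by move=> xS -> ->; rewrite -fE mem_positions imset_f.
by rewrite -{1}(tpermK a a1 i) fE index_map.
Qed.

(** The left factor of a product of permutations acts first, so [tperm p q] exchanges the ranks of
    [a] and [a1] before [s] is applied. Indices out of range are fixed on both sides. *)
Lemma perm_nat_rank_tperm L S (a a1 i : 'I_n) (p q : 'I_L) (s : 'S_L) :
    a \in S -> a1 \in S -> rank S a = p.+1 -> rank S a1 = q.+1 ->
  perm_nat (tperm p q * s) (rank S i) = perm_nat s (rank S (tperm a a1 i)).
Proof.
move=> aS a1S rp rq.
have pE (u : 'S_L) (o : 'I_L) : perm_nat u o.+1 = (u o).+1 by rewrite /= valK.
case: tpermP => [->|->|ia ia1].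
- by rewrite rp rq !pE permM tpermL.
- by rewrite rp rq !pE permM tpermR.
rewrite /rank /=; case: insubP => //= o _ oE; rewrite permM tpermD //.
  by apply/eqP=> po; apply: ia; apply/esym/(rank_inj aS); rewrite rp /rank -oE po.
by apply/eqP=> qo; apply: ia1; apply/esym/(rank_inj a1S); rewrite rq /rank -oE qo.
Qed.

Lemma perm_nat_rank L S i (s : 'S_L) : #|S| = L -> i \in S ->
  exists2 o : 'I_L, rank S i = o.+1 & perm_nat s (rank S i) = (s o).+1.
Proof.
move=> cS iS; have lt_i : (index (val i) (positions S) < L)%N.
  by rewrite -cS; apply: rank_le_card.
by exists (Ordinal lt_i); rewrite //= insubT.
Qed.

End Ranks.

(** The condition [s p < s q] picks one permutation from each pair. Doubling the sum instead would
    fail in characteristic 2. *)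
Lemma sum_tperm_cancel (V : zmodType) L (p q : 'I_L) (D : 'S_L -> V) : p != q ->
  (forall s, D s + D (tperm p q * s)%g = 0) -> \sum_s D s = 0.
Proof.
move=> pq D0; rewrite (bigID (fun s : 'S_L => s p < s q)%N) /=.
rewrite [X in _ + X](reindex_inj (mulgI (tperm p q))) /=.
rewrite [X in _ + X](eq_bigl (fun s : 'S_L => s p < s q)%N); last first.
  move=> s; rewrite !permM tpermL tpermR -leqNgt leq_eqVlt.
  by rewrite val_eqE (inj_eq perm_inj) (negPf pq).
by rewrite -big_split big1 // => s _; apply: D0.
Qed.

(** * Partial symmetrizations, level by level *)

Section PartialSym.
Variables (F : fieldType) (n : nat) (L : nat -> nat) (h : F).
Implicit Types (S : nat -> {set 'I_n}) (t : nat -> nat -> F) (X Y : 'I_n -> F).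

Definition assign t (A : {set 'I_n}) j (s : 'S_(L j)) (i : 'I_n) : F :=
  t j (perm_nat s (rank A i)).

(** The recursion starts from a level 0 that is empty in the application, where its single
    permutation contributes 1. *)
Fixpoint partial_sym t S (m : nat) Y : F :=
  if m is j.+1 then
    \sum_(s : 'S_(L j)) partial_sym t S j (assign t (S j) s) *
                        level h (S j) (S j.+1) (assign t (S j) s) Y
  else 1.

Lemma eq_partial_sym t t' S m X X' :
    (forall j b, (j < m)%N -> t j b = t' j b) -> X =1 X' ->
  partial_sym t S m X = partial_sym t' S m X'.
Proof.
elim: m X X' => //= m IH X X' et eX; apply: eq_bigr => s _.
have ea : assign t (S m) s =1 assign t' (S m) s by move=> i; rewrite /assign et.
congr (_ * _); last exact: eq_pairprod.
by apply: IH => // j b /ltnW/et->.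
Qed.

Lemma eq_partial_sym_set t S S' m X :
  (forall j, (j <= m)%N -> S j = S' j) -> partial_sym t S m X = partial_sym t S' m X.
Proof.
elim: m X => //= m IH X eS.
by apply: eq_bigr => s _; rewrite !eS // IH // => j /leqW/eS.
Qed.

(** * Relations under the swap of two adjacent positions *)

Variables (a a1 : 'I_n).
Hypothesis a1E : a1 = a.+1 :> nat.
Let tau := tperm a a1.

Lemma tperm_stable (A : {set 'I_n}) : (a \in A) = (a1 \in A) -> tau @: A = A.
Proof.
move=> eA; have tA x : x \in A -> tau x \in A.
  by rewrite /tau; case: tpermP => [->|->|//]; rewrite eA.
apply/setP=> i; apply/imsetP/idP => [[x xA ->]|iA]; first exact: tA.
by exists (tau i); rewrite ?tA // /tau tpermK.
Qed.

Lemma mem_tperm_l (A : {set 'I_n}) : (a \in tau @: A) = (a1 \in A).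
Proof. by rewrite -{1}(tpermR a a1) mem_imset //; apply: perm_inj. Qed.

Lemma mem_tperm_r (A : {set 'I_n}) : (a1 \in tau @: A) = (a \in A).
Proof. by rewrite -{1}(tpermL a a1) mem_imset //; apply: perm_inj. Qed.

Variables (t : nat -> nat -> F) (S : nat -> {set 'I_n}) (N p q : nat).
Hypotheses (p_gt0 : (0 < p)%N) (le_pq : (p <= q)%N).
Hypothesis card_S : forall j, (j < N)%N -> #|S j| = L j.
Hypothesis aS : forall j, (j <= N)%N -> (a \in S j) = (p <= j)%N.
Hypothesis a1S : forall j, (j <= N)%N -> (a1 \in S j) = (q <= j)%N.
Hypothesis t_neq0 : forall j b, (1 <= j < N)%N -> (1 <= b <= L j)%N -> t j b != 0.
Hypothesis t_neq : forall j b c, (1 <= j < N)%N -> (1 <= b <= L j)%N ->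
  (1 <= c <= L j)%N -> b != c -> t j b != t j c.

Let S' j := tau @: S j.
Let V := partial_sym t S.
Let V' := partial_sym t S'.

(** Below the level [q] where [a1] enters, the swap is an order-preserving relabelling: ranks and
    off-pair factors are unchanged, and [level_on] is 1. *)
Lemma partial_sym_below j X : (j < q)%N -> (j <= N)%N -> V' j (X \o tau) = V j X.
Proof.
rewrite /V /V'; elim: j X => //= j IH X jq jN; apply: eq_bigr => s _.
have a1j : a1 \notin S j by rewrite a1S ?(ltnW jN) // -ltnNge ltnW.
have a1j1 : a1 \notin S j.+1 by rewrite a1S // -ltnNge.
have as' : assign t (S' j) s =1 assign t (S j) s \o tau.
  by move=> i; congr (t j (perm_nat s _)); apply: rank_tperm.
rewrite (@eq_partial_sym t t S' j _ _ (fun _ _ _ => erefl _) as') IH ?(ltnW jq) ?(ltnW jN) //.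
rewrite /level (eq_pairprod _ _ _ _ as' (fun=> erefl _)) -!/(level _ _ _ _ _).
rewrite !(levelE _ a1E) level_off_l // level_off_r // /level_on.
rewrite !mem_tperm_l !mem_tperm_r (negPf a1j) (negPf a1j1).
by rewrite !mulr1 !if_same !mulr1.
Qed.

(* The R-matrix relation with its denominators cleared. *)
Definition rmatrix_rel (f f' : ('I_n -> F) -> F) := forall X,
  (X a1 - h * X a) * f' (X \o tau) = h * (X a1 - X a) * f X + (1 - h) * X a1 * f' X /\
  (X a1 - h * X a) * f (X \o tau) = (X a1 - X a) * f' X + (1 - h) * X a * f X.

Lemma S'_stable j : (q <= j)%N -> (j <= N)%N -> S' j = S j.
Proof.
move=> qj jN; apply: tperm_stable.
by rewrite aS // a1S // qj (leq_trans le_pq).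
Qed.

(** [S q] is stable under [tau], but the level below lacks [a1]. Write [x] for the value at [a]
    below and [u], [v] for those at [a], [a1] above. If [a] is present below, the summands of [V]
    and [V'] differ only in a factor, [1 - v / x] against [1 - h * u / x]. *)
Lemma rmatrix_base : (q <= N)%N -> rmatrix_rel (V q) (V' q).
Proof.
move=> qN; have [j qE] : exists j, q = j.+1.
  by exists q.-1; rewrite prednK // (leq_trans p_gt0).
have jN : (j < N)%N by rewrite -qE.
have S'q : S' j.+1 = S j.+1 by rewrite S'_stable // qE.
have a1j : a1 \notin S j by rewrite a1S ?(ltnW jN) // qE ltnn.
have a1j1 : a1 \in S j.+1 by rewrite a1S // qE.
rewrite qE.
have aj1 : a \in S j.+1 by rewrite -S'q mem_tperm_l.
have off_r X Y : level_off h a a1 (S j) (S j.+1) X (Y \o tau) =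
    level_off h a a1 (S j) (S j.+1) X Y.
  by rewrite -{1}S'q level_off_r.
(* The coefficient common to [V] and [V']; it sees [Y] only through off-pair factors, hence is
   invariant under [tau]. *)
pose c Y (s : 'S_(L j)) := V j (assign t (S j) s) *
  level_off h a a1 (S j) (S j.+1) (assign t (S j) s) Y.
have VE Y : V j.+1 Y = \sum_(s : 'S_(L j)) c Y s *
    (if a \in S j then 1 - Y a1 / assign t (S j) s a else 1).
  apply: eq_bigr => s _; rewrite (levelE _ a1E) mulrA /level_on.
  by rewrite (negPf a1j) a1j1 !mulr1.
have V'E Y : V' j.+1 Y = \sum_(s : 'S_(L j)) c Y s *
    (if a \in S j then 1 - h * Y a / assign t (S j) s a else 1).
  rewrite /V' /=; apply: eq_bigr => s _.
  have as' : assign t (S' j) s =1 assign t (S j) s \o tau.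
    by move=> i; congr (t j (perm_nat s _)); apply: rank_tperm.
  rewrite (@eq_partial_sym t t S' j _ _ (fun _ _ _ => erefl _) as').
  rewrite [partial_sym _ _ _ _]partial_sym_below ?qE ?(ltnW jN) //.
  rewrite /level (eq_pairprod _ _ _ _ as' (fun=> erefl _)) -!/(level _ _ _ _ _).
  rewrite (levelE _ a1E) S'q level_off_l // mulrA /level_on.
  by rewrite !mem_tperm_l !mem_tperm_r (negPf a1j) aj1 mul1r /= /tau tpermR.
move=> X; rewrite !VE !V'E !mulr_sumr -!big_split /=.
have cE s : c (X \o tau) s = c X s by rewrite /c off_r.
(* If [a] enters together with [a1], the pair factors are 1 and the relations reduce to
   [v - h * u = h * (v - u) + (1 - h) * v] and [v - h * u = (v - u) + (1 - h) * u]. *)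
by split; apply: eq_bigr => s _; rewrite cE /= /tau ?tpermL ?tpermR;
   case: (a \in S j); ring.
Qed.

(** [level_on] when both positions are present on both levels: [x], [y] are the lower values at [a],
    [a1], and [u], [v] the upper ones. *)
Definition exchange_kernel (x y u v : F) : F :=
  (1 - v / x) * ((1 - h * y / x) / (1 - y / x)) * (1 - h * u / y).

(* [exchange_kernel y x] contains the factor [y - h x] by which [A'] and [B'] are
   multiplied in the hypotheses, so nothing is lost when it vanishes. *)
Lemma exchange_identity (x y u v A B A' B' : F) : x != 0 -> y != 0 -> x != y ->
    (y - h * x) * B' = h * (y - x) * A + (1 - h) * y * B ->
    (y - h * x) * A' = (y - x) * B + (1 - h) * x * A ->
  let sym C C' u v := C * exchange_kernel x y u v + C' * exchange_kernel y x u v in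
  (v - h * u) * sym B B' v u = h * (v - u) * sym A A' u v + (1 - h) * v * sym B B' u v /\
  (v - h * u) * sym A A' v u = (v - u) * sym B B' u v + (1 - h) * u * sym A A' u v.
Proof.
move=> x0 y0 xy rB rA sym.
have xy0 : x - y != 0 by rewrite subr_eq0.
have yx0 : y - x != 0 by rewrite subr_eq0 eq_sym.
have KE (C' C u' v' : F) : (y - h * x) * C' = C ->
   C' * exchange_kernel y x u' v' = (1 - v' / y) * (1 - h * u' / x) / (y - x) * C.
  by move=> <-; rewrite /exchange_kernel; field; rewrite ?x0 ?y0 ?yx0.
rewrite /sym !(KE _ _ _ _ rB) !(KE _ _ _ _ rA) /exchange_kernel.
by split; field; rewrite ?x0 ?y0 ?xy0 ?yx0.
Qed.

(** Both levels are stable under [tau], so [V] and [V'] are summed against the same factors. The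
    terms of [s] and [tperm pa pa1 * s] carry [X] and [X \o tau]; the relation at level [j] links
    them, and [exchange_identity] settles each pair. *)
Lemma rmatrix_step j : (q <= j)%N -> (j < N)%N ->
  rmatrix_rel (V j) (V' j) -> rmatrix_rel (V j.+1) (V' j.+1).
Proof.
move=> qj jN rel_j Y.
have j_gt0 : (1 <= j < N)%N by rewrite jN andbT (leq_trans p_gt0) // (leq_trans le_pq).
have S'j := S'_stable qj (ltnW jN); have S'j1 := S'_stable (leqW qj) jN.
have aj : a \in S j by rewrite -S'j mem_tperm_l a1S // ltnW.
have a1j : a1 \in S j by rewrite a1S // ltnW.
have aj1 : a \in S j.+1 by rewrite -S'j1 mem_tperm_l a1S // leqW.
have a1j1 : a1 \in S j.+1 by rewrite a1S // leqW.
(* The indices of [a] and [a1] in row [j]; the permutation 1 is an arbitrary choice. *)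
have [pa rpa _] := perm_nat_rank 1%g (card_S jN) aj.
have [pa1 rpa1 _] := perm_nat_rank 1%g (card_S jN) a1j.
have pq : pa != pa1.
  apply: contra_neq (a_neq_a1 a1E) => ep; apply: (rank_inj a1j).
  by rewrite rpa rpa1 ep.
pose X (s : 'S_(L j)) := assign t (S j) s.
have Xpair s : X (tperm pa pa1 * s)%g =1 X s \o tau.
  by move=> i; congr (t j _); apply: perm_nat_rank_tperm.
have X0 s i : i \in S j -> X s i != 0.
  move=> iS; rewrite /X /assign; have [o _ ->] := perm_nat_rank s (card_S jN) iS.
  by apply: t_neq0; rewrite /= ?ltn_ord.
have Xneq s : X s a != X s a1.
  rewrite /X /assign rpa rpa1 /= !valK /=; apply: t_neq; rewrite /= ?ltn_ord //.
  by rewrite eqSS val_eqE (inj_eq perm_inj).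
pose c s := level_off h a a1 (S j) (S j.+1) (X s) Y.
have c_pair s : c (tperm pa pa1 * s)%g = c s.
  rewrite /c /level_off (eq_pairprod _ _ _ _ (Xpair s) (fun=> erefl _)).
  by rewrite -/(level_off _ _ _ _ _ _ _) -{1}S'j level_off_l.
pose K s Z := exchange_kernel (X s a) (X s a1) (Z a) (Z a1).
have K_pair s Z : K (tperm pa pa1 * s)%g Z = exchange_kernel (X s a1) (X s a) (Z a) (Z a1).
  by rewrite /K !Xpair /= /tau tpermL tpermR.
have levelK s Z : level h (S j) (S j.+1) (X s) Z =
    level_off h a a1 (S j) (S j.+1) (X s) Z * K s Z.
  by rewrite (levelE _ a1E) /level_on aj a1j aj1 a1j1.
have off_r s : level_off h a a1 (S j) (S j.+1) (X s) (Y \o tau) = c s.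
  by rewrite -{1}S'j1 level_off_r.
have VE Z : V j.+1 Z = \sum_(s : 'S_(L j)) V j (X s) * level h (S j) (S j.+1) (X s) Z by [].
have V'E Z : V' j.+1 Z = \sum_(s : 'S_(L j)) V' j (X s) * level h (S j) (S j.+1) (X s) Z.
  by rewrite /V' /= S'j S'j1.
have V_pair W s :
    partial_sym t W j (X (tperm pa pa1 * s)%g) = partial_sym t W j (X s \o tau).
  exact: eq_partial_sym.
rewrite !VE !V'E !mulr_sumr -!big_split /=.
split; apply/eqP; rewrite -subr_eq0 -sumrB; apply/eqP.
all: apply: (sum_tperm_cancel pq) => s.
all: rewrite !levelK !off_r -!/(c _) !c_pair !K_pair /V /V' !V_pair.
all: rewrite /K /= /tau ?tpermL ?tpermR.
all: have [rB rA] := rel_j (X s).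
all: have [E1 E2] :=
  exchange_identity (Y a) (Y a1) (X0 s a aj) (X0 s a1 a1j) (Xneq s) rB rA.
all: move/eqP: E1; rewrite -subr_eq0 => /eqP E1.
all: move/eqP: E2; rewrite -subr_eq0 => /eqP E2.
(* The sum over a pair is [c s] times the vanishing difference in [E1] or [E2]. *)
all: rewrite -/tau -!/(V _ _) -!/(V' _ _) -(mulr0 (c s)).
- rewrite -E1; ring.
- rewrite -E2; ring.
Qed.

Lemma rmatrix_partial_sym j : (q <= j)%N -> (j <= N)%N -> rmatrix_rel (V j) (V' j).
Proof.
move=> /subnK <-; elim: (j - q)%N => [|d IH]; first by rewrite add0n; apply: rmatrix_base.
by move=> dN; apply: rmatrix_step; rewrite ?leq_addl //; apply/IH/ltnW.
Qed.

End PartialSym.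

(** * From iterated symmetrization to [partial_sym] *)

Section Symmetrization.
Variables (F : fieldType) (lam : nat -> nat).
Implicit Types (G : (nat -> nat -> F) -> F) (t : nat -> nat -> F) (l : seq nat).

Definition sym_levels l G := foldr (fun k G' => symk lam k G') G l.

Lemma eq_sym_levels l G G' t : (forall t, G t = G' t) ->
  sym_levels l G t = sym_levels l G' t.
Proof. by move=> eG; elim: l t => //= k l IH t; apply: eq_bigr => s _; apply: IH. Qed.

Lemma sym_levels_sum (T : finType) (G : T -> (nat -> nat -> F) -> F) l t :
  sym_levels l (fun t => \sum_i G i t) t = \sum_i sym_levels l (G i) t.
Proof.
elim: l t => //= k l IH t; rewrite /symk exchange_big /=.
by apply: eq_bigr => s _; apply: IH.
Qed.

Lemma sym_levels_mulr G (c : F) l t :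
  sym_levels l (fun t => G t * c) t = sym_levels l G t * c.
Proof.
elim: l t => //= k l IH t; rewrite /symk big_distrl /=.
by apply: eq_bigr => s _; apply: IH.
Qed.

(** Symmetrizing other levels never alters row [k]. *)
Lemma sym_levels_freeze (B : (nat -> F) -> (nat -> nat -> F) -> F) k l t : k \notin l ->
  sym_levels l (fun t => B (t k) t) t = sym_levels l (B (t k)) t.
Proof.
elim: l t => //= k' l IH t; rewrite inE => /norP[kk' kl].
by apply: eq_bigr => s _; rewrite [LHS]IH // (negPf kk').
Qed.

Lemma sym_levels_rcons l k G : sym_levels (rcons l k) G = sym_levels l (symk lam k G).
Proof. by rewrite /sym_levels -cats1 foldr_cat. Qed.

Variables (n : nat) (h : F) (S : nat -> {set 'I_n}).

(** The unsymmetrized product of levels 1 to [m], with the values on level [m.+1] kept as an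
    argument so that a permuted row or [z] can be inserted. *)
Fixpoint chain t (m : nat) (Y : 'I_n -> F) : F :=
  if m is j.+1 then
    chain t j (t j.+1 \o rank (S j.+1)) *
    level h (S j.+1) (S j.+2) (t j.+1 \o rank (S j.+1)) Y
  else 1.

Lemma eq_chain t k (x : nat -> F) m Y : (m < k)%N ->
  chain (fun j b => if j == k then x b else t j b) m Y = chain t m Y.
Proof.
elim: m Y => //= m IH Y mk.
by rewrite IH ?(ltnW mk) // (ltn_eqF mk).
Qed.

Lemma sym_levels_chain m t Y : S 0%N = set0 ->
  sym_levels (iota 1 m) (fun t => chain t m Y) t = partial_sym (lamc lam) h t S m.+1 Y.
Proof.
move=> S0; elim: m t Y => [|m IH] t Y.
  rewrite /= S0 (eq_bigr (fun=> 1)) => [|s _].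
    by rewrite sumr_const /= card_Sn /lamc big_geq.
  by rewrite mul1r /level /pairprod big_set0.
have -> : iota 1 m.+1 = rcons (iota 1 m) m.+1 by rewrite -{1}[m.+1]addn1 iotaD cats1 add1n.
rewrite sym_levels_rcons.
pose B s (x : nat -> F) := (fun i => x (@perm_nat (lamc lam m.+1) s (rank (S m.+1) i))).
rewrite (@eq_sym_levels _ _ (fun t => \sum_s chain t m (B s (t m.+1)) *
   level h (S m.+1) (S m.+2) (B s (t m.+1)) Y)); last first.
  move=> t'; apply: eq_bigr => s _ /=; rewrite eqxx.
  by rewrite eq_chain.
rewrite sym_levels_sum; apply: eq_bigr => s _.
have m1 : m.+1 \notin iota 1 m by rewrite mem_iota; lia.
rewrite (sym_levels_freeze (fun x t => chain t m (B s x) *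
   level h (S m.+1) (S m.+2) (B s x) Y)) //.
by rewrite sym_levels_mulr IH.
Qed.

End Symmetrization.

(** * The weight function as a partial symmetrization *)

Section WeightFunction.
Variables (F : fieldType) (n : nat) (lam : nat -> nat) (h : F).

(** The rank is an increasing bijection from positions to indices, so [b > a] turns into an
    inequality of positions. Coinciding positions satisfy neither strict condition, matching the
    value 1 of [cross]. *)
Lemma levelE_indices (A B : {set 'I_n}) (x y : nat -> F) :
  \prod_(1 <= a < #|A|.+1)
    ((\prod_(1 <= c < #|B|.+1 | (nth 0%N (positions B) c.-1 < nth 0%N (positions A) a.-1)%N)
        (1 - h * y c / x a)) *
     (\prod_(1 <= c < #|B|.+1 | (nth 0%N (positions A) a.-1 < nth 0%N (positions B) c.-1)%N)
        (1 - y c / x a)) *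
     (\prod_(a.+1 <= b < #|A|.+1)
        ((1 - h * x b / x a) / (1 - x b / x a))))
  = level h A B (x \o rank A) (y \o rank B).
Proof.
rewrite (big_rank _ _ A (fun _ _ => true) (fun a v =>
   (\prod_(1 <= c < #|B|.+1 | (nth 0%N (positions B) c.-1 < v)%N) (1 - h * y c / x a)) *
   (\prod_(1 <= c < #|B|.+1 | (v < nth 0%N (positions B) c.-1)%N) (1 - y c / x a)) *
   (\prod_(a.+1 <= b < #|A|.+1) ((1 - h * x b / x a) / (1 - x b / x a))))).
apply: eq_big => [i|i]; rewrite andbT // => iA.
rewrite (big_rank _ _ B (fun _ v => v < val i)%N (fun c _ => 1 - h * y c / x (rank A i))).
rewrite (big_rank _ _ B (fun _ v => val i < v)%N (fun c _ => 1 - y c / x (rank A i))).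
rewrite (big_nat_widenl _ 1) //=.
rewrite (big_rank _ _ A (fun b _ => rank A i < b)%N
  (fun b _ => (1 - h * x b / x (rank A i)) / (1 - x b / x (rank A i)))).
congr (_ * _); rewrite !big_mkcondr.
  rewrite -big_split /=; apply: eq_bigr => j jB; rewrite /cross.
  by case: (ltngtP i j) => _; rewrite ?mulr1 ?mul1r.
by apply: eq_bigr => j jA; rewrite ltn_rank.
Qed.

Variables (N : nat) (I : nat -> {set 'I_n}).
Hypothesis N_gt0 : (0 < N)%N.
Hypothesis card_blocks : forall j, (j <= N)%N -> #|blockU I j| = lamc lam j.
Hypothesis blocksT : blockU I N = [set: 'I_n].

(** The first argument of [U_I] only bounds the product over levels, which allows induction on
    it. *)
Lemma U_I_chain t m : (m < N)%N ->
  U_I m.+1 lam I h t = chain h (blockU I) t m (t m.+1 \o rank (blockU I m.+1)).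
Proof.
elim: m => [|m IH] mN; first by rewrite /U_I big_geq.
rewrite /= -IH ?(ltnW mN) // /U_I big_nat_recr //=; congr (_ * _).
by rewrite -levelE_indices !card_blocks ?(ltnW mN).
Qed.

Lemma W_I_partial_sym t (z : 'I_n -> F) :
  W_I N lam I t z h = (1 - h) ^+ lam1 N lam * partial_sym (lamc lam) h t (blockU I) N z.
Proof.
congr (_ * _); rewrite /symAll -/(sym_levels _ _ _).
have UE t' m := @U_I_chain t' m.
case: N N_gt0 blocksT UE => // M _ IT UE /=.
rewrite (@eq_sym_levels _ _ _ _ (fun t =>
  chain h (blockU I) t M (t M.+1 \o rank (blockU I M.+1)))); last first.
  by move=> t'; apply: UE.
rewrite (sym_levels_freeze lam (fun x t =>
  chain h (blockU I) t M (x \o rank (blockU I M.+1)))); last first.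
  by rewrite mem_iota; lia.
rewrite sym_levels_chain; last by rewrite /blockU big_geq.
apply: eq_partial_sym => [j b jM|i] /=; rewrite /ttz ?(ltn_eqF jM) //.
(* In the full set position [i] has rank [i.+1], where row [N] returns [z i]. *)
by rewrite eqxx IT rank_setT /= valK.
Qed.

End WeightFunction.

(** * Unions of blocks of an ordered partition *)

Section Blocks.
Variables (n N : nat) (lam : nat -> nat) (I : nat -> {set 'I_n}).

Lemma blockUP k (x : 'I_n) :
  reflect (exists2 j, (1 <= j <= k)%N & x \in I j) (x \in blockU I k).
Proof.
elim: k => [|k IH].
  by rewrite /blockU big_geq // inE; constructor; case=> j; lia.
rewrite /blockU big_nat_recr //= inE -/(blockU I k).
apply: (iffP orP) => [[/IH[j jk xj]|xk]|[j]].
- by exists j => //; lia.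
- by exists k.+1 => //; lia.
case: (ltngtP j k.+1) => [jk|jk|->] jk1 xj; [left|lia|by right].
by apply/IH; exists j => //; lia.
Qed.

Lemma imset_blockU (s : 'I_n -> 'I_n) k : blockU (fun j => s @: I j) k = s @: blockU I k.
Proof.
rewrite /blockU; elim: k => [|k IH]; first by rewrite !big_geq // imset0.
by rewrite big_nat_recr //= IH [in RHS]big_nat_recr //= imsetU.
Qed.

Lemma in_Ilam_perm (s : 'S_n) : in_Ilam N lam I -> in_Ilam N lam (fun k => s @: I k).
Proof.
case=> cI covI disI; split=> [k kN|x|k l kN lN kl].
- by rewrite card_imset ?cI //; apply: perm_inj.
- have [k kN xk] := covI (s^-1 x)%g.
  by exists k => //; apply/imsetP; exists (s^-1 x)%g; rewrite ?permKV.
- by rewrite imset_disjoint ?disI //; apply: perm_inj.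
Qed.

Hypothesis HI : in_Ilam N lam I.

Lemma block_uniq x k l : (1 <= k <= N)%N -> (1 <= l <= N)%N ->
  x \in I k -> x \in I l -> k = l.
Proof.
case: HI => _ _ dis kN lN xk xl; apply/eqP; apply: contraT => /eqP kl.
by have := disjointFr (dis _ _ kN lN kl) xk; rewrite xl.
Qed.

Lemma mem_blockU x k j : (1 <= k <= N)%N -> x \in I k -> (j <= N)%N ->
  (x \in blockU I j) = (k <= j)%N.
Proof.
move=> kN xk jN; apply/blockUP/idP => [[i ij xi]|kj].
  have -> : k = i by apply: (block_uniq kN _ xk xi); lia.
  lia.
by exists k => //; lia.
Qed.

Lemma card_blockU j : (j <= N)%N -> #|blockU I j| = lamc lam j.
Proof.
elim: j => [|j IH] jN; first by rewrite /blockU /lamc !big_geq // cards0.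
rewrite /blockU /lamc big_nat_recr //= [in RHS]big_nat_recr //= -/(blockU I j) -/(lamc lam j).
rewrite -IH ?(ltnW jN) //; have [<- // _ _] := HI.
rewrite cardsU (_ : _ :&: _ = set0) ?cards0 ?subn0 //.
apply/setP=> x; rewrite !inE; apply/negP=> /andP[/blockUP[i ij xi] xj].
have : i = j.+1 by apply: (@block_uniq x) => //; lia.
lia.
Qed.

Lemma blockU_setT : blockU I N = [set: 'I_n].
Proof. by case: HI => _ cov _; apply/setP=> x; rewrite inE; apply/blockUP/cov. Qed.

End Blocks.

(** * The three cases, from the relations at level [N] *)

Theorem theorem6p10 (F : fieldType) (n N : nat) (lam : nat -> nat)
  (Hlam : (\sum_(1 <= k < N.+1) lam k)%N = n)
  (sigma : 'S_n) (a a1 : 'I_n) (Ha1 : val a1 = (val a).+1)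
  (I : nat -> {set 'I_n}) (HI : in_Ilam N lam I)
  (k l : nat) (Hk : (1 <= k <= N)%N) (Hl : (1 <= l <= N)%N)
  (Hak : sigma a \in I k) (Hal : sigma a1 \in I l)
  (t : nat -> nat -> F) (z : 'I_n -> F) (h : F)
  (Ht0 : forall j b, (1 <= j < N)%N -> (1 <= b <= lamc lam j)%N -> t j b != 0)
  (Htd : forall j b c, (1 <= j < N)%N -> (1 <= b <= lamc lam j)%N ->
          (1 <= c <= lamc lam j)%N -> b != c -> t j b != t j c)
  (Hz0 : forall i, z i != 0)
  (Hw : 1 - h * (z (sigma a) / z (sigma a1)) != 0) :
  let w := z (sigma a) / z (sigma a1) in
  let sigma' := (tperm a a1 * sigma)%g in
  let I' := fun j => tperm (sigma a) (sigma a1) @: I j in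
  [/\ (k = l -> W_sig N lam sigma' I t z h = W_sig N lam sigma I t z h),
      ((k < l)%N -> W_sig N lam sigma' I t z h =
          h * (1 - w) / (1 - h * w) * W_sig N lam sigma I t z h
          + (1 - h) / (1 - h * w) * W_sig N lam sigma I' t z h) &
      ((l < k)%N -> W_sig N lam sigma' I t z h =
          (1 - w) / (1 - h * w) * W_sig N lam sigma I t z h
          + (1 - h) * w / (1 - h * w) * W_sig N lam sigma I' t z h)].
Proof.
move=> w sigma' I'.
pose tau := tperm a a1; pose y i := z (sigma i).
pose S j := (sigma^-1)%g @: blockU I j; pose S' j := tau @: S j.
pose c := (1 - h) ^+ lam1 N lam.
pose V (A : nat -> {set 'I_n}) := partial_sym (lamc lam) h t A N.
have WE (K : nat -> {set 'I_n}) A x : in_Ilam N lam K -> (forall j, blockU K j = A j) ->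
    W_I N lam K t x h = c * V A x.
  move=> HK eA; rewrite W_I_partial_sym.
  - by congr (_ * _); apply: eq_partial_sym_set.
  - by case: (N) Hk => //; lia.
  - by move=> j; apply: card_blockU.
  - exact: blockU_setT HK.
have Esig : W_sig N lam sigma I t z h = c * V S y.
  by apply: WE => [|j]; [apply: in_Ilam_perm | rewrite imset_blockU].
(* The swap acts twice here: on the blocks, since the inverse of [sigma'] is [sigma^-1] followed by
   [tau], and on the order of the [z]. *)
have Esig' : W_sig N lam sigma' I t z h = c * V S' (y \o tau).
  rewrite /W_sig (WE _ S') => [||j]; first 1 last.
  - exact: in_Ilam_perm.
  - rewrite imset_blockU /S' /S -imset_comp; apply: eq_imset => x /=.
    by rewrite /sigma' invMg permM tpermV.
  congr (_ * _); apply: eq_partial_sym => // i.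
  by rewrite /= /sigma' permM.
(* Conjugation by [sigma] carries the transposition of [sigma a] and [sigma a1] to [tau]. *)
have EsigI' : W_sig N lam sigma I' t z h = c * V S' y.
  apply: WE => [|j]; first by do 2!apply: in_Ilam_perm.
  rewrite imset_blockU /I' imset_blockU /S' /S -!imset_comp; apply: eq_imset => x /=.
  by rewrite -tpermJ /conjg !permM permK.
have a1E : a1 = a.+1 :> nat by [].
have HJ : in_Ilam N lam (fun j => (sigma^-1)%g @: I j) by apply: in_Ilam_perm.
have cS j : (j < N)%N -> #|S j| = lamc lam j.
  by move=> /ltnW jN; rewrite /S -imset_blockU (card_blockU HJ).
have cS' j : (j < N)%N -> #|S' j| = lamc lam j.
  by move=> jN; rewrite card_imset ?cS //; apply: perm_inj.
have mem_inv b m (A : nat -> {set 'I_n}) : sigma b \in A m -> b \in (sigma^-1)%g @: A m.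
  by move=> bA; rewrite -[b](permK sigma) imset_f.
have aS j : (j <= N)%N -> (a \in S j) = (k <= j)%N.
  by move=> jN; rewrite /S -imset_blockU (mem_blockU HJ Hk _ jN) // mem_inv.
have a1S j : (j <= N)%N -> (a1 \in S j) = (l <= j)%N.
  by move=> jN; rewrite /S -imset_blockU (mem_blockU HJ Hl _ jN) // mem_inv.
have aS' j : (j <= N)%N -> (a \in S' j) = (l <= j)%N.
  by move=> jN; rewrite /S' mem_tperm_l a1S.
have a1S' j : (j <= N)%N -> (a1 \in S' j) = (k <= j)%N.
  by move=> jN; rewrite /S' mem_tperm_r aS.
have S'K j : tau @: S' j = S j.
  by rewrite /S' -imset_comp -[RHS]imset_id; apply: eq_imset => x /=; rewrite tpermK.
have z1 : z (sigma a1) != 0 by [].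
(* This is [1 - h * w] times [z (sigma a1)]. *)
have z1w : z (sigma a1) - h * z (sigma a) != 0.
  by have := mulf_neq0 Hw z1; rewrite mulrBl mul1r -mulrA divfK.
have solve (A B C p q : F) : (y a1 - h * y a) * A = p * B + q * C ->
    c * A = p / (y a1 - h * y a) * (c * B) + q / (y a1 - h * y a) * (c * C).
  move=> E; apply: (mulfI z1w).
  transitivity (c * ((y a1 - h * y a) * A)); first by rewrite /y; ring.
  by rewrite E /y; field.
have [kN lN] : (0 < k)%N /\ (l <= N)%N by lia.
have [l0 k1] : (0 < l)%N /\ (k <= N)%N by lia.
rewrite Esig Esig' EsigI'; split=> kl.
(* Now [S'] and [S] agree up to level [N], and the two coefficients add up to the left one:
   [(v - u) + (1 - h) * u = v - h * u]. *)
- have [_ R2] := rmatrix_partial_sym h a1E kN (eq_leq kl) cS aS a1S Ht0 Htd lN (leqnn N) y.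
  have eS x : V S' x = V S x.
    apply: eq_partial_sym_set => j jN; apply: tperm_stable.
    by rewrite aS // a1S // kl.
  rewrite eS; congr (_ * _); apply: (mulfI z1w).
  rewrite [LHS]R2 [partial_sym _ _ _ _ _ _]eS /y.
  by rewrite -/(V S) -/(V _ _); ring.
- have [R1 _] := rmatrix_partial_sym h a1E kN (ltnW kl) cS aS a1S Ht0 Htd lN (leqnn N) y.
  rewrite (solve _ _ _ _ _ R1) /w /y; congr (_ * _ + _ * _); field.
    by rewrite z1 z1w.
  by rewrite z1 z1w.
(* Here [a1] enters [S] first, so the relations are applied to [S'], where [a] enters first and
   whose swap is [S]. *)
- have [_ R2] := rmatrix_partial_sym h a1E l0 (ltnW kl) cS' aS' a1S' Ht0 Htd k1 (leqnn N) y.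
  have eS : partial_sym (lamc lam) h t (fun j => tau @: S' j) N y = V S y.
    by apply: eq_partial_sym_set => j _; apply: S'K.
  rewrite eS in R2; rewrite (solve _ _ _ _ _ R2) /w /y; congr (_ * _ + _ * _); field.
    by rewrite z1 z1w.
  by rewrite z1 z1w.
Qed.
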